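(* Let $\mathbf A$ be an algebra belonging to the variety of sets, that is, an algebra without operations. Then every tolerance of $\mathbf A$ is weakly representable.
   Context: A binary relation on (the universe $A$ of) an algebra $\mathbf A$ is compatible (also called admissible) if it is preserved by all basic operations of $\mathbf A$. A tolerance of $\mathbf A$ is a reflexive, symmetric, compatible binary relation on $\mathbf A$. For binary relations $R,S$ on $A$, $R\circ S=\{(x,y): \exists z\ (x,z)\in R,\ (z,y)\in S\}$, and $R^-$ denotes the converse of $R$. A tolerance $\Theta$ of $\mathbf A$ is weakly representable if and only if there exist a set $K$ (possibly infinite) and compatible reflexive relations $R_k$ ($k\in K$) on $\mathbf A$ such that $\Theta=\bigcap_{k\in K}(R_k\circ R_k^-)$, the intersection being taken inside $A\times A$. *)

(* Defs.v *)
From mathcomp Require Import all_boot.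
From mathcomp Require Import classical_sets.

Set Implicit Arguments.
Unset Strict Implicit.
Unset Printing Implicit Defensive.

Local Open Scope classical_set_scope.

Record signature := Signature {
  op_symbol : Type;
  arity : op_symbol -> nat
}.

Record algebra (S : signature) := Algebra {
  universe :> Type;
  interp : forall f : op_symbol S, ('I_(arity f) -> universe) -> universe
}.

(* Constants are operations of arity 0, so they are excluded as well. *)
Definition without_operations (S : signature) (A : algebra S) : Prop :=
  op_symbol S -> False.

Section Relations.
Variables (S : signature) (A : algebra S).
Implicit Types R : set (A * A).

Definition reflexive_rel R : Prop := forall x, R (x, x).

Definition symmetric_rel R : Prop := forall x y, R (x, y) -> R (y, x).

Definition compatible R : Prop :=
  forall (f : op_symbol S) (x y : 'I_(arity f) -> A),
    (forall i, R (x i, y i)) -> R (interp x, interp y).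

(* In the library's relation_scope, [B \; A] means "first A, then B"; here
   relations compose from left to right. *)
Definition rel_comp R1 R2 : set (A * A) :=
  [set xy | exists2 z, R1 (xy.1, z) & R2 (z, xy.2)].

Definition tolerance R : Prop :=
  [/\ reflexive_rel R, symmetric_rel R & compatible R].

(* For K empty the intersection is the full relation on A; allowing this
   changes nothing, as the full relation R satisfies R = rel_comp R R^-1. *)
Definition weakly_representable (Theta : set (A * A)) : Prop :=
  exists (K : Type) (R : K -> set (A * A)),
    (forall k, compatible (R k) /\ reflexive_rel (R k)) /\
    Theta = \bigcap_(k in [set: K]) rel_comp (R k) ((R k)^-1)%relation.

End Relations.

(* Main.v *)
Require Import Defs.
From mathcomp Require Import all_boot.
From mathcomp Require Import boolp classical_sets.

(** Without operations every relation is compatible, so only reflexivity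
    constrains the relations [R_k].  A symmetric relation is the intersection,
    over the pairs [(a, b)] outside it, of the sets [A * A] minus
    [{(a, b), (b, a)}].  By reflexivity of the tolerance such a pair has
    [a <> b], and then each of these sets has the form [R o R^-]
    ([rel_comp_frozen]): let [a] and [b] be related only to themselves, and
    every other element to all of [A]. *)

Local Open Scope classical_set_scope.

(** Two elements are related by [R o R^-] when their [R]-images meet: here the
    images of [a] and [b] are [{a}] and [{b}], the smallest that reflexivity
    allows, and all other images are as large as possible. *)
Definition frozen {T : Type} (a b : T) : set (T * T) :=
  [set xy | xy.1 = xy.2 \/ ~ (xy.1 = a \/ xy.1 = b)].

Lemma frozen_reflexive (S : signature) (A : algebra S) (a b : A) :
  reflexive_rel (frozen a b).
Proof. by move=> x; left. Qed.

Lemma compatible_without_operations (S : signature) (A : algebra S)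
  (hA : without_operations A) (R : set (A * A)) : compatible R.
Proof. by move=> f; case: (hA f). Qed.

(** The images of [x] and [y] meet in [y] if [x] has full image, and in [x] if
    [y] does; otherwise both are singletons from [{a}], [{b}]. *)
Lemma rel_comp_frozen (S : signature) (A : algebra S) (a b : A) :
  a <> b ->
  rel_comp (frozen a b) ((frozen a b)^-1)%relation =
  ~` [set (a, b); (b, a)].
Proof.
move=> neq_ab; apply/seteqP; split=> -[x y] /=.
  case=> z Rxz Ryz [] [ex ey]; subst x y.
    case: Rxz => /= [eaz|]; last by case; left.
    by case: Ryz => /= [ebz|]; [apply: neq_ab; rewrite eaz ebz | case; right].
  case: Rxz => /= [ebz|]; last by case; right.
  by case: Ryz => /= [eaz|]; [apply: neq_ab; rewrite eaz ebz | case; left].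
move=> Nxy.
have [xab|Nxab] := EM (x = a \/ x = b); last by exists y; [right|left].
have [yab|Nyab] := EM (y = a \/ y = b); last by exists x; [left|right].
case: xab yab => -> [] -> in Nxy *.
- by exists a; left.
- by case: Nxy; left.
- by case: Nxy; right.
- by exists b; left.
Qed.

Theorem proposition3 (S : signature) (A : algebra S)
  (hA : without_operations A) (Theta : set (A * A)) :
  tolerance Theta -> weakly_representable Theta.
Proof.
move=> [Trefl Tsym _].
have neq p : ~ Theta p -> p.1 <> p.2.
  by case: p => a b /= Nab eab; apply: Nab; rewrite eab.
exists {p : A * A | ~ Theta p}, (fun k => frozen (sval k).1 (sval k).2).
split=> [k|].
  by split; [exact: compatible_without_operations | exact: frozen_reflexive].
apply/seteqP; split=> [[x y] Txy [[a b] Nab] _|[x y] Hxy].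
  rewrite rel_comp_frozen /=; last exact: neq Nab.
  by case=> -[ex ey]; subst x y; apply: Nab => //; exact: Tsym.
apply: contrapT => Nxy; move: (Hxy (exist _ (x, y) Nxy) I).
by rewrite rel_comp_frozen /=; [apply; left | exact: neq Nxy].
Qed.
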